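(* Let $q\ge 2$ be an integer and let $A_0 \in \{-1,0,1\}^{m_0\times n_0}$ be an $\mathrm{EQ}_q$ matrix. For integers $k\ge 1$ define $A_k$ recursively as the block matrix with $q$ block rows and $q+1$ block columns \[ A_k=\begin{bmatrix} A_{k-1} & A_{k-1} & A_{k-1} & \cdots & A_{k-1} & I_{m_{k-1}}\\ A_{k-1} & -A_{k-1} & 0 & \cdots & 0 & 0\\ 0 & A_{k-1} & -A_{k-1} & \cdots & 0 & 0\\ \vdots & & & \ddots & & \vdots\\ 0 & 0 & \cdots & A_{k-1} & -A_{k-1} & 0 \end{bmatrix}, \] i.e., the first block row consists of $q$ copies of $A_{k-1}$ followed by the $m_{k-1}\times m_{k-1}$ identity $I_{m_{k-1}}$, and for $j=1,\dots,q-1$ the $(j+1)$-th block row has $A_{k-1}$ in block column $j$, $-A_{k-1}$ in block column $j+1$, and zero blocks elsewhere (including a zero $m_{k-1}\times m_{k-1}$ block in the last block column). Here $A_{k-1}$ has size $m_{k-1}\times n_{k-1}$. Then for every integer $k\ge 0$, $A_k$ is an $\mathrm{EQ}_q$ matrix of size $m_k\times n_k$ with $m_k=q^k m_0$ and $n_k = q^k n_0\left(\frac{k}{q}\frac{m_0}{n_0}+1\right)$.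
   Context: For an integer $q\ge 2$, a matrix $A\in\mathbb{Z}^{m\times n}$ is called an $\mathrm{EQ}_q$ matrix if the homogeneous system $Ax=0$ has no non-trivial solution $x\in\{-q+1,\dots,q-1\}^n$. *)

(* Defs.v *)
From HB Require Import structures.
From mathcomp Require Import all_boot all_order all_algebra.

Set Implicit Arguments.
Unset Strict Implicit.
Unset Printing Implicit Defensive.

Import Order.TTheory GRing.Theory Num.Theory.
Local Open Scope ring_scope.

Definition is_EQ (q m n : nat) (A : 'M[int]_(m, n)) : Prop :=
  ~ exists x : 'cV[int]_n,
      [/\ forall i, - q%:Z + 1 <= x i 0 <= q%:Z - 1, A *m x = 0 & x != 0].

(* Block rows and columns are indexed from 0, so for i > 0 block row i has A in
   column i - 1 and - A in column i; the last block column is the right-hand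
   argument of row_mx. *)
Definition EQ_step (q m n : nat) (A : 'M[int]_(m, n)) :
    'M[int]_(\sum_(i < q) m, \sum_(j < q) n + m) :=
  row_mx
    (\mxblock_(i < q, j < q)
       (if i == 0%N :> nat then A
        else if j.+1 == i :> nat then A
        else if j == i :> nat then - A
        else 0))
    (\mxcol_(i < q) ((if i == 0%N :> nat then 1%:M else 0) : 'M[int]_m)).

(* The sizes are kept in the form produced by \mxblock and row_mx, so that the
   recursion EQ_seq typechecks without casts. *)
Fixpoint EQ_rows (q m0 k : nat) : nat :=
  if k is k'.+1 then (\sum_(i < q) EQ_rows q m0 k')%N else m0.

Fixpoint EQ_cols (q m0 n0 k : nat) : nat :=
  if k is k'.+1 then (\sum_(j < q) EQ_cols q m0 n0 k' + EQ_rows q m0 k')%N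
  else n0.

Fixpoint EQ_seq (q m0 n0 : nat) (A0 : 'M[int]_(m0, n0)) (k : nat) :
    'M[int]_(EQ_rows q m0 k, EQ_cols q m0 n0 k) :=
  if k is k'.+1 then EQ_step q (EQ_seq q A0 k') else A0.

(* Main.v *)
(** Write a solution of [A_k x = 0] as [x = (x_1, ..., x_q, y)].  The lower block
rows force [A_(k-1) x_1 = ... = A_(k-1) x_q], so the first one reads
[q A_(k-1) x_1 + y = 0].  The entries of [y] are multiples of [q] smaller than
[q] in absolute value, hence [y = 0], every [x_j] lies in the kernel of
[A_(k-1)], and induction applies. *)
Require Import Defs.
From HB Require Import structures.
From mathcomp Require Import all_boot all_order all_algebra.
From mathcomp Require Import zify ring.

Set Implicit Arguments.
Unset Strict Implicit.
Unset Printing Implicit Defensive.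

Import Order.TTheory GRing.Theory Num.Theory.
Local Open Scope ring_scope.

(** Guarded sums in the lower block rows avoid naming the predecessor of [i] in ['I_q]. *)
Lemma EQ_step_mul (q m n : nat) (A : 'M[int]_(m, n))
    (X : 'I_q -> 'cV[int]_n) (y : 'cV[int]_m) :
  EQ_step q A *m col_mx (\mxcol_j X j) y =
  \mxcol_(i < q) (if i == 0%N :> nat then \sum_j A *m X j + y
            else \sum_(j < q) ((if j.+1 == i :> nat then A *m X j else 0) -
                         (if j == i then A *m X j else 0))).
Proof.
rewrite /EQ_step mul_row_col mul_mxblock_mxrow mxcol_mul -mxcolD.
apply: eq_mxcol => i; case: ifP => i0; first by rewrite mul1mx.
rewrite mul0mx addr0; apply: eq_bigr => j _; rewrite -val_eqE /=.
case: (eqVneq j.+1 i) => [ji|_].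
  by rewrite (_ : (j == i :> nat) = false) ?subr0 //; apply/eqP; lia.
by case: ifP => _; rewrite ?mulNmx ?mul0mx sub0r ?oppr0.
Qed.

Lemma EQ_step_ker (q m n : nat) (A : 'M[int]_(m, n))
    (X : 'I_q -> 'cV[int]_n) (y : 'cV[int]_m) :
  EQ_step q A *m col_mx (\mxcol_j X j) y = 0 ->
  forall i, A *m X i *+ q = - y.
Proof.
case: q X => [X _ []//|q X]; rewrite EQ_step_mul -mxcol0 => /eq_mxcolP eq0.
have eqX0 j : A *m X j = A *m X ord0.
  case: j => j; elim: j => [|j IHj] ltj; first by congr (A *m X _); apply: val_inj.
  have ltj' : (j < q.+1)%N := ltnW ltj.
  rewrite -(IHj ltj'); apply/esym/eqP; rewrite -subr_eq0; apply/eqP.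
  (* Block row [j.+1] compares blocks [j] and [j.+1]: each of its two guarded sums has exactly one
     surviving term. *)
  have := eq0 (Ordinal ltj); rewrite /= => <-; rewrite sumrB -!big_mkcond /=.
  rewrite (big_pred1 (Ordinal ltj')) => [|i]; first by rewrite big_pred1_eq.
  by rewrite eqSS.
move=> i; apply/eqP; rewrite -addr_eq0 -(eq0 ord0) /= eqX0.
by under eq_bigr do rewrite eqX0; rewrite sumr_const card_ord.
Qed.

Lemma EQ_step_is_EQ (q m n : nat) (A : 'M[int]_(m, n)) :
  (0 < q)%N -> is_EQ q A -> is_EQ q (EQ_step q A).
Proof.
move=> q_gt0 EQ_A [x [x_box Ax0 /negP[]]].
rewrite -[x]vsubmxK -[usubmx x]submxcolK in Ax0 *.
set X := submxcol (usubmx x) in Ax0 *; set y := dsubmx x in Ax0 *.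
have AX := EQ_step_ker Ax0.
have y0 : y = 0.
  apply/matrixP => i j; rewrite ord1 [RHS]mxE.
  have /matrixP/(_ i 0) := AX (Ordinal q_gt0).
  rewrite mulmxnE [RHS]mxE -mulr_natr natz; move: ((A *m _) i 0) => a.
  have : - q%:Z + 1 <= y i 0 <= q%:Z - 1 by rewrite mxE; apply: x_box.
  move: (y i 0) => b qaE b_box.
  (* For nonzero [a], the entry [b = - a * q] would have absolute value at least [q] and leave the
     box. *)
  by case: (ltgtP a 0) qaE => [a_lt0|a_gt0|a0] qaE; nia.
suff X0 j : X j = 0.
  by rewrite y0 (eq_mxcol (fun j => X0 j)) mxcol0 col_mx0.
apply/eqP/negP => Xj0; apply: EQ_A; exists (X j); split=> [i||].
- by rewrite !mxE; apply: x_box.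
(* Once [y] vanishes, [AX] says that [q] times [A *m X j] is zero, and a positive [q] cancels in the
   integers. *)
- apply/matrixP => i k; have /matrixP/(_ i k)/eqP := AX j.
  by rewrite y0 oppr0 mulmxnE !mxE mulrn_eq0 gtn_eqF // => /eqP.
- exact/negP.
Qed.

Lemma EQ_rowsE (q m0 k : nat) : EQ_rows q m0 k = (q ^ k * m0)%N.
Proof.
by elim: k => [|k IHk] /=; rewrite ?mul1n // IHk sum_nat_const card_ord expnS mulnA.
Qed.

(** Solves n_(k+1) = q n_k + q^k m0, whose last term counts the columns of the identity block. The
    truncated [k.-1] is harmless at [k = 0], where its factor [k] vanishes. *)
Lemma EQ_colsE (q m0 n0 k : nat) :
  EQ_cols q m0 n0 k = (q ^ k * n0 + k * q ^ k.-1 * m0)%N.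
Proof.
elim: k => [|k IHk] /=; first by rewrite mul1n addn0.
rewrite IHk EQ_rowsE sum_nat_const card_ord expnS.
by case: k {IHk} => [|k] /=; rewrite ?expnS; ring.
Qed.

Theorem theorem2 (q m0 n0 : nat) (A0 : 'M[int]_(m0, n0))
  (hq : (2 <= q)%N) (hn0 : (0 < n0)%N)
  (hA0 : forall i j, A0 i j \in [:: -1; 0; 1])
  (hEQ : is_EQ q A0) (k : nat) :
  [/\ is_EQ q (EQ_seq q A0 k),
      EQ_rows q m0 k = (q ^ k * m0)%N
    & (EQ_cols q m0 n0 k)%:R =
      q%:R ^+ k * n0%:R * (k%:R / q%:R * (m0%:R / n0%:R) + 1) :> rat].
Proof.
have q_gt0 : (0 < q)%N := ltnW hq.
split; [|exact: EQ_rowsE|].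
  by elim: k => [//|k IHk]; apply: EQ_step_is_EQ.
have q_neq0 : q%:R != 0 :> rat by rewrite pnatr_eq0 -lt0n.
have n0_neq0 : n0%:R != 0 :> rat by rewrite pnatr_eq0 -lt0n.
rewrite EQ_colsE natrD !natrM !natrX.
(* Only for positive [k] is [q ^ k.-1] equal to [q ^ k / q]; at 0 both terms carrying the factor [k]
   vanish. *)
case: k => [|k] /=; first by field; apply/andP.
by rewrite exprS; field; apply/andP.
Qed.
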